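(* Let $p$ be an odd prime, let $c\in\mathbb{Q}_p$, and let $f:\mathbb{Q}_p^2\to\mathbb{Q}_p^2$, $f(x,y)=(xy+c,x)$. Let $Z=\{(x,y)\in\mathsf{Q}:|x|=|y|=1\}$ and $R=\{(x,y)\in\mathsf{Q}:|x|=|y|=|c|\}$. If $|c|<1$, then $Z\subset\mathcal{K}^-\subset R\cup Z$.
   Context: $|\cdot|$ is the $p$-adic norm on $\mathbb{Q}_p$ (with $|p|=1/p$). The inverse of $f$ is the map $f^{-1}(x,y)=\left(y,\frac{x-c}{y}\right)$, defined for $y\neq 0$; $f^{-n}$ denotes its $n$-th iterate. $\mathsf{Q}=\{(x,y)\in\mathbb{Q}_p^2: f^{-n}(x,y)\text{ exists for all positive integers } n\}$; writing $(x_{-n},y_{-n})=f^{-n}(x,y)$, with $(x_0,y_0)=(x,y)$, this means $y_{-n}\neq 0$ for all $n\ge 0$. The backward Julia set is $\mathcal{K}^-=\{(x,y)\in\mathsf{Q}:(f^{-n}(x,y))_{n\ge 1}\text{ is bounded}\}$, bounded with respect to $\|(x,y)\|=\max\{|x|,|y|\}$. *)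

(* Defs.v *)
From HB Require Import structures.
From mathcomp Require Import all_boot all_order all_algebra.
From mathcomp Require Import generic_quotient ring_quotient.
From mathcomp Require Import all_classical all_reals all_analysis.
From mathcomp Require Import ring lra zify.

Set Implicit Arguments.
Unset Strict Implicit.
Unset Printing Implicit Defensive.

Import Order.TTheory GRing.Theory Num.Theory.
Import numFieldNormedType.Exports.

Local Open Scope classical_set_scope.
Local Open Scope ring_scope.
Local Open Scope quotient_scope.

Definition padic_rat (p : nat) (q : rat) : rat :=
  if q == 0 then 0
  else p%:Q ^ ((logn p `|denq q|)%:Z - (logn p `|numq q|)%:Z).

Section PadicRat.
Variables (p : nat) (p_pr : prime p).
Local Notation v := (padic_rat p).

Let p_gt0 : 0 < p%:Q :> rat.
Proof. by rewrite ltr0n prime_gt0. Qed.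

Let p_neq0 : p%:Q != 0 :> rat.
Proof. by rewrite gt_eqF. Qed.

Let p_gt1 : 1 < p%:Q :> rat.
Proof. by rewrite ltr1n prime_gt1. Qed.

Lemma padic_rat0 : v 0 = 0.
Proof. by rewrite /padic_rat eqxx. Qed.

Lemma padic_rat_fracE (a b : int) : a != 0 -> b != 0 ->
  v (a%:Q / b%:Q) = p%:Q ^ ((logn p `|b|)%:Z - (logn p `|a|)%:Z).
Proof.
move=> a0 b0; rewrite /padic_rat.
have aQ : a%:Q != 0 by rewrite intr_eq0.
have bQ : b%:Q != 0 by rewrite intr_eq0.
have q0 : a%:Q / b%:Q != 0 by rewrite mulf_neq0 ?invr_eq0.
rewrite (negPf q0); set q := a%:Q / b%:Q in q0 *.
have E : a * denq q = numq q * b.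
  apply/eqP; rewrite -(eqr_int rat) !intrM -[X in _ == X * _]mulr1.
  have dQ : (denq q)%:Q != 0 by rewrite intr_eq0 denq_neq0.
  rewrite numqE mulr1 /q; apply/eqP; field.
  by rewrite bQ.
have /(congr1 (logn p)) : (`|a| * `|denq q| = `|numq q| * `|b|)%N.
  by rewrite -!abszM E.
rewrite !lognM ?absz_gt0 ?denq_neq0 ?numq_eq0 // => H.
by congr (_ ^ _); lia.
Qed.

Lemma padic_rat_eq0 q : (v q == 0) = (q == 0).
Proof.
by rewrite /padic_rat; case: ifP => // _; rewrite expfz_eq0 (negPf p_neq0) andbF.
Qed.

Lemma padic_rat_ge0 q : 0 <= v q.
Proof. by rewrite /padic_rat; case: ifP => // _; rewrite exprz_ge0 // ltW. Qed.

Lemma padic_ratM q r : v (q * r) = v q * v r.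
Proof.
have [->|q0] := eqVneq q 0; first by rewrite mul0r padic_rat0 mul0r.
have [->|r0] := eqVneq r 0; first by rewrite mulr0 padic_rat0 mulr0.
rewrite -(divq_num_den q) -(divq_num_den r) mulf_div -!intrM.
rewrite !padic_rat_fracE ?mulf_neq0 ?numq_eq0 ?denq_neq0 //.
rewrite -expfzDr //; congr (_ ^ _).
rewrite !abszM !lognM ?absz_gt0 ?numq_eq0 ?denq_neq0 //; lia.
Qed.

Lemma padic_rat1 : v 1 = 1.
Proof.
have v10 : v 1 != 0 by rewrite padic_rat_eq0 oner_eq0.
by apply: (mulfI v10); rewrite -padic_ratM !mulr1.
Qed.

Lemma padic_ratV q : v q^-1 = (v q)^-1.
Proof.
have [->|q0] := eqVneq q 0; first by rewrite !(invr0, padic_rat0).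
apply: (@mulfI _ (v q)); first by rewrite padic_rat_eq0.
by rewrite -padic_ratM !divff ?padic_rat1 ?padic_rat_eq0.
Qed.

Lemma padic_ratN q : v (- q) = v q.
Proof. by rewrite /padic_rat oppr_eq0 denqN numqN abszN. Qed.

Lemma padic_ratB q r : v (q - r) = v (r - q).
Proof. by rewrite -opprB padic_ratN. Qed.

Lemma padic_ratD q r : v (q + r) <= Num.max (v q) (v r).
Proof.
have [->|q0] := eqVneq q 0; first by rewrite add0r le_max lexx orbT.
have [->|r0] := eqVneq r 0; first by rewrite addr0 le_max lexx.
have [->|s0] := eqVneq (q + r) 0.
  by rewrite padic_rat0 le_max padic_rat_ge0.
pose a := numq q * denq r; pose b := numq r * denq q; pose d := denq q * denq r.
have dq : (denq q)%:Q != 0 by rewrite intr_eq0 denq_neq0.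
have dr : (denq r)%:Q != 0 by rewrite intr_eq0 denq_neq0.
have d0 : d != 0 by rewrite mulf_neq0 ?denq_neq0.
have a0 : a != 0 by rewrite mulf_neq0 ?denq_neq0 ?numq_eq0.
have b0 : b != 0 by rewrite mulf_neq0 ?denq_neq0 ?numq_eq0.
have Eq : q = a%:Q / d%:Q.
  by rewrite -{1}(divq_num_den q) !intrM; field; rewrite dq dr.
have Er : r = b%:Q / d%:Q.
  by rewrite -{1}(divq_num_den r) !intrM; field; rewrite dq dr.
have Es : q + r = (a + b)%:Q / d%:Q by rewrite intrD mulrDl -Eq -Er.
have ab0 : a + b != 0.
  by apply: contraNneq s0 => ab0; rewrite Es ab0 mul0r.
rewrite Es Eq Er !padic_rat_fracE // le_max !ler_eXz2l //.
have : (minn (logn p `|a|) (logn p `|b|) <= logn p `|(a + b)%R|)%N.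
  rewrite -pfactor_dvdn ?absz_gt0 //.
  have dvdE k (z : int) : (p ^ k %| `|z|)%N = ((p ^ k)%N%:Z %| z)%Z.
    by rewrite dvdzE.
  rewrite dvdE; apply: rpredD; rewrite -dvdE pfactor_dvdn ?absz_gt0 //.
    exact: geq_minl.
  exact: geq_minr.
by rewrite geq_min => /orP[H|H]; apply/orP; [left|right]; lia.
Qed.

Lemma padic_ratD_lt q r e : v q < e -> v r < e -> v (q + r) < e.
Proof.
by move=> qe re; apply: le_lt_trans (padic_ratD q r) _; rewrite gt_max qe re.
Qed.

Lemma padic_ratB_lt q r e : v q < e -> v r < e -> v (q - r) < e.
Proof. by move=> qe re; apply: padic_ratD_lt => //; rewrite padic_ratN. Qed.

Lemma padic_rat_near q r : v (q - r) < v r -> v q = v r.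
Proof.
move=> H; apply/eqP; rewrite eq_le; apply/andP; split.
  rewrite -(subrK r q); apply: le_trans (padic_ratD _ _) _.
  by rewrite ge_max lexx ltW.
have := padic_ratD q (r - q); rewrite addrC subrK le_max => /orP[//|].
by rewrite padic_ratB leNgt H.
Qed.

End PadicRat.

Definition padic_cauchy (p : nat) (x : nat -> rat) : Prop :=
  forall e : rat, 0 < e -> exists N, forall m n, (N <= m)%N -> (N <= n)%N ->
    padic_rat p (x m - x n) < e.

Definition padic_null (p : nat) (x : nat -> rat) : Prop :=
  forall e : rat, 0 < e -> exists N, forall n, (N <= n)%N ->
    padic_rat p (x n) < e.

Section CauchyFacts.
Variables (p : nat) (p_pr : prime p).
Local Notation v := (padic_rat p).

Lemma padic_cauchy_cst q : padic_cauchy p (fun=> q).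
Proof. by move=> e e0; exists 0%N => m n _ _; rewrite subrr padic_rat0. Qed.

Lemma padic_cauchyB x y :
  padic_cauchy p x -> padic_cauchy p y -> padic_cauchy p (x - y).
Proof.
move=> hx hy e e0; have [N hN] := hx e e0; have [M hM] := hy e e0.
exists (maxn N M) => m n; rewrite !geq_max => /andP[Nm Mm] /andP[Nn Mn].
have -> : (x - y) m - (x - y) n = (x m - x n) - (y m - y n).
  by rewrite !fctE; ring.
by apply: padic_ratB_lt => //; [apply: hN|apply: hM].
Qed.

Lemma padic_cauchy_bounded x : padic_cauchy p x ->
  exists2 B, 0 < B & exists N, forall n, (N <= n)%N -> v (x n) < B.
Proof.
move=> /(_ 1 ltr01)[N hN]; exists (1 + v (x N)).
  by rewrite ltr_pwDl ?padic_rat_ge0.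
exists N => n Nn; rewrite -(subrK (x N) (x n)).
apply: padic_ratD_lt => //.
  by rewrite ltr_wpDr ?padic_rat_ge0 // hN.
by rewrite ltr_pwDl.
Qed.

Lemma padic_mul_lt q r B e : 0 < B -> v q < B -> v r < e / B -> v (q * r) < e.
Proof.
move=> B0 qB re; rewrite padic_ratM //.
apply: le_lt_trans (_ : B * v r < e).
  by rewrite ler_wpM2r ?padic_rat_ge0 // ltW.
by rewrite mulrC -ltr_pdivlMr.
Qed.

Lemma padic_cauchyM x y :
  padic_cauchy p x -> padic_cauchy p y -> padic_cauchy p (x * y).
Proof.
move=> hx hy e e0.
have [A A0 [NA hA]] := padic_cauchy_bounded hx.
have [B B0 [NB hB]] := padic_cauchy_bounded hy.
have [N hN] := hx _ (divr_gt0 e0 B0); have [M hM] := hy _ (divr_gt0 e0 A0).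
exists (maxn (maxn NA NB) (maxn N M)) => m n.
rewrite !geq_max => /andP[/andP[? ?] /andP[? ?]] /andP[/andP[? ?] /andP[? ?]].
have -> : (x * y) m - (x * y) n = x m * (y m - y n) + y n * (x m - x n).
  by rewrite !fctE; ring.
by apply: padic_ratD_lt => //;
  [apply: padic_mul_lt A0 (hA _ _) (hM _ _ _ _)|
   apply: padic_mul_lt B0 (hB _ _) (hN _ _ _ _)].
Qed.

Lemma padic_nullD x y :
  padic_null p x -> padic_null p y -> padic_null p (x + y).
Proof.
move=> hx hy e e0; have [N hN] := hx e e0; have [M hM] := hy e e0.
exists (maxn N M) => n; rewrite geq_max => /andP[? ?].
by apply: padic_ratD_lt => //; [apply: hN|apply: hM].
Qed.

Lemma padic_nullM x y :
  padic_cauchy p x -> padic_null p y -> padic_null p (x * y).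
Proof.
move=> hx hy e e0.
have [A A0 [N hN]] := padic_cauchy_bounded hx.
have [M hM] := hy _ (divr_gt0 e0 A0).
exists (maxn N M) => n; rewrite geq_max => /andP[? ?].
exact: padic_mul_lt A0 (hN _ _) (hM _ _).
Qed.

Lemma padic_cauchy_nonnull x : padic_cauchy p x -> ~ padic_null p x ->
  exists2 N, x N != 0 & forall n, (N <= n)%N -> v (x n) = v (x N).
Proof.
move=> hx nx.
have [e e0 he] : exists2 e : rat, 0 < e &
    forall N, exists2 n, (N <= n)%N & e <= v (x n).
  apply: contrapT => H; apply: nx => e e0; apply: contrapT => H'.
  apply: H; exists e => // N; apply: contrapT => H''; apply: H'.
  exists N => n Nn; rewrite ltNge; apply/negP => en.
  by apply: H''; exists n.
have [N hN] := hx e e0; have [n Nn en] := he N; exists n.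
  by rewrite -(padic_rat_eq0 p_pr) gt_eqF // (lt_le_trans e0).
move=> m nm; apply: padic_rat_near => //.
by apply: lt_le_trans en; apply: hN => //; apply: leq_trans nm.
Qed.

Lemma padic_cauchyV x : padic_cauchy p x -> ~ padic_null p x ->
  padic_cauchy p (fun n => (x n)^-1).
Proof.
move=> hx nx e e0.
have [N xN hN] := padic_cauchy_nonnull hx nx.
have vN0 : 0 < v (x N) by rewrite lt_def padic_rat_eq0 // xN padic_rat_ge0.
have [M hM] := hx _ (mulr_gt0 e0 (mulr_gt0 vN0 vN0)).
exists (maxn N M) => m n; rewrite !geq_max => /andP[Nm Mm] /andP[Nn Mn].
have xm0 : x m != 0 by rewrite -(padic_rat_eq0 p_pr) hN // padic_rat_eq0.
have xn0 : x n != 0 by rewrite -(padic_rat_eq0 p_pr) hN // padic_rat_eq0.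
have -> : (x m)^-1 - (x n)^-1 = (x n - x m) / (x m * x n).
  by field; rewrite xm0 xn0.
rewrite padic_ratM // padic_ratV // padic_ratM // (hN m) // (hN n) //.
by rewrite ltr_pdivrMr ?mulr_gt0 //; apply: hM.
Qed.

End CauchyFacts.

(* The types below carry the proof of primality because their algebraic
   structure depends on it. *)
Definition cauchy_pred (p : nat) (p_pr : prime p) : {pred nat -> rat} :=
  fun x => `[< padic_cauchy p x >].

Section PadicField.
Variables (p : nat) (p_pr : prime p).

Fact cauchy_subring_closed : subring_closed (cauchy_pred p_pr).
Proof.
split=> [|x y|x y].
- exact/asboolP/padic_cauchy_cst.
- by move=> /asboolP hx /asboolP hy; apply/asboolP/padic_cauchyB.
- by move=> /asboolP hx /asboolP hy; apply/asboolP/padic_cauchyM.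
Qed.

HB.instance Definition _ := GRing.isSubringClosed.Build (nat -> rat)
  (cauchy_pred p_pr) cauchy_subring_closed.

Record cauchy_seq := CauchySeq {
  cauchy_val :> nat -> rat;
  _ : cauchy_val \in cauchy_pred p_pr }.

HB.instance Definition _ := [isSub for cauchy_val].
HB.instance Definition _ := [Choice of cauchy_seq by <:].
HB.instance Definition _ := [SubChoice_isSubComNzRing of cauchy_seq by <:].

Lemma cauchy_seqP (x : cauchy_seq) : padic_cauchy p x.
Proof. by case: x => y hy /=; exact/asboolP. Qed.

Definition null_pred : {pred cauchy_seq} := fun x => `[< padic_null p x >].

Fact null_idealr_closed : idealr_closed null_pred.
Proof.
split.
- by apply/asboolP => e e0; exists 0%N => n _; rewrite padic_rat0.
- apply/negP => /asboolP /(_ 1 ltr01)[N /(_ N (leqnn N))].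
  by rewrite padic_rat1 // ltxx.
- move=> a x y /asboolP hx /asboolP hy; apply/asboolP.
  apply: (@padic_nullD p p_pr (a * x : nat -> rat) y) => //.
  exact: padic_nullM (cauchy_seqP a) hx.
Qed.

HB.instance Definition _ :=
  isIdealr.Build cauchy_seq null_pred null_idealr_closed.

(* The completion of the rationals: Cauchy sequences for the p-adic norm modulo
   null sequences. *)
Definition Qp : Type := {ideal_quot null_pred}.

HB.instance Definition _ := GRing.ComNzRing.on Qp.
HB.instance Definition _ := Quotient.on Qp.

Definition cauchy_inv (x : cauchy_seq) : cauchy_seq :=
  insubd 0 (fun n => (x n)^-1).

Definition Qp_inv (x : Qp) : Qp :=
  if x == 0 then 0 else \pi_Qp (cauchy_inv (repr x)).

Lemma Qp_pi0 : \pi_Qp 0 = 0.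
Proof. by rewrite /Qp !piE. Qed.

Lemma Qp_pi1 : \pi_Qp 1 = 1.
Proof. by rewrite /Qp !piE. Qed.

Lemma Qp_piD : {morph \pi_Qp : x y / x + y >-> x + y}.
Proof. by move=> x y; rewrite /Qp !piE. Qed.

Lemma Qp_piB : {morph \pi_Qp : x y / x - y >-> x - y}.
Proof. by move=> x y; rewrite /Qp !piE. Qed.

Lemma Qp_piM : {morph \pi_Qp : x y / x * y >-> x * y}.
Proof. by move=> x y; rewrite /Qp !piE. Qed.

Lemma Qp_pi_eq (x y : cauchy_seq) :
  \pi_Qp x = \pi_Qp y <-> padic_null p (x - y).
Proof.
have E : (x - y \in null_pred) = (\pi_Qp x == \pi_Qp y).
  by rewrite Quotient.idealrBE.
split=> [/eqP|h]; first by rewrite -E => /asboolP.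
by apply/eqP; rewrite -E; apply/asboolP.
Qed.

Fact Qp_mulVf (x : Qp) : x != 0 -> Qp_inv x * x = 1.
Proof.
move=> x0; rewrite /Qp_inv (negPf x0).
have nx : ~ padic_null p (repr x).
  move=> h; move/eqP: x0; apply; rewrite -[x]reprK -Qp_pi0.
  by apply/Qp_pi_eq; rewrite subr0.
have hV := padic_cauchyV p_pr (cauchy_seqP (repr x)) nx.
have [N xN hN] := padic_cauchy_nonnull p_pr (cauchy_seqP (repr x)) nx.
rewrite -[x in X in _ * X]reprK -Qp_piM -Qp_pi1; apply/Qp_pi_eq => e e0.
exists N => n Nn.
have xn0 : repr x n != 0 by rewrite -(padic_rat_eq0 p_pr) hN // padic_rat_eq0.
have -> : (cauchy_inv (repr x) * repr x - 1) n = (repr x n)^-1 * repr x n - 1.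
  rewrite /cauchy_inv /insubd insubT //; exact/asboolP.
by rewrite mulVf // subrr padic_rat0.
Qed.

Fact Qp_invr0 : Qp_inv 0 = 0.
Proof. by rewrite /Qp_inv eqxx. Qed.

HB.instance Definition _ := GRing.ComNzRing_isField.Build Qp Qp_mulVf Qp_invr0.

(* The limit exists: a Cauchy sequence either has p-adic norms tending to 0,
   or its p-adic norms are eventually constant. *)
Definition padic_norm (R : realType) (x : Qp) : R :=
  limn (fun n => ratr (padic_rat p (repr x n)) : R).

Section Norm.
Variable R : realType.
Local Notation norm := (padic_norm R).

Lemma padic_norm_pi_cst (x : cauchy_seq) (q : rat) N :
  (forall n, (N <= n)%N -> padic_rat p (x n) = q) ->
  norm (\pi_Qp x) = ratr q.
Proof.
move=> hx; set y := repr (\pi_Qp x).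
have xy : padic_null p (y - x) by apply/Qp_pi_eq; rewrite /y reprK.
apply/cvg_lim => //.
have [q0|q0] := eqVneq q 0.
  apply/cvgrPdist_lt => e e0.
  pose e' : rat := (Num.truncn e^-1).+1%:R^-1.
  have e'0 : 0 < e' by rewrite invr_gt0 ltr0n.
  have e'e : ratr e' < e.
    by rewrite /e' fmorphV /= ratr_nat invf_plt ?posrE ?ltr0n // truncnS_gt.
  have [M hM] := xy _ e'0.
  exists (maxn N M) => // n /=; rewrite geq_max => /andP[Nn Mn].
  rewrite q0 rmorph0 sub0r normrN ger0_norm ?ler0q ?padic_rat_ge0 //.
  apply: lt_trans e'e; rewrite ltr_rat -(subrK (x n) (y n)).
  by apply: padic_ratD_lt; rewrite ?hx ?q0 //; exact: hM.
have q_gt0 : 0 < q.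
  by rewrite lt_def q0 -(hx N (leqnn N)) padic_rat_ge0.
have [M hM] := xy _ q_gt0.
apply: cvg_near_cst; exists (maxn N M) => // n /=; rewrite geq_max => /andP[Nn Mn].
congr ratr; rewrite -(hx n Nn); apply: padic_rat_near => //.
by rewrite hx //; exact: hM.
Qed.

Lemma padic_norm0 : norm 0 = 0.
Proof.
rewrite -Qp_pi0 (@padic_norm_pi_cst 0 0 0%N) ?rmorph0 // .
Qed.

Lemma Qp_repr_nonnull (x : Qp) : x != 0 ->
  exists2 N, repr x N != 0 &
    forall n, (N <= n)%N -> padic_rat p (repr x n) = padic_rat p (repr x N).
Proof.
move=> x0; apply: padic_cauchy_nonnull => //; first exact: cauchy_seqP.
move=> h; move/eqP: x0; apply; rewrite -[x]reprK -Qp_pi0.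
by apply/Qp_pi_eq; rewrite subr0.
Qed.

Lemma padic_norm_expz (x : Qp) : x != 0 ->
  exists k : int, norm x = p%:R ^ k.
Proof.
move=> /Qp_repr_nonnull[N xN hN].
rewrite -[x]reprK (padic_norm_pi_cst hN) /padic_rat (negPf xN).
by eexists; rewrite fmorphXz /= ratr_int.
Qed.

Lemma padic_norm_eq0 (x : Qp) : (norm x == 0) = (x == 0).
Proof.
have [->|/padic_norm_expz[k ->]] := eqVneq x 0; first by rewrite padic_norm0 eqxx.
by rewrite expfz_eq0 pnatr_eq0 eqn0Ngt prime_gt0 // andbF.
Qed.

Lemma padic_norm_ge0 (x : Qp) : 0 <= norm x.
Proof.
have [->|/padic_norm_expz[k ->]] := eqVneq x 0; first by rewrite padic_norm0.
by rewrite exprz_ge0 // ler0n.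
Qed.

Lemma padic_normM (x y : Qp) : norm (x * y) = norm x * norm y.
Proof.
have [->|x0] := eqVneq x 0; first by rewrite !(mul0r, padic_norm0).
have [->|y0] := eqVneq y 0; first by rewrite !(mulr0, padic_norm0).
have [N xN hN] := Qp_repr_nonnull x0; have [M yM hM] := Qp_repr_nonnull y0.
rewrite -[in LHS](reprK x) -[in LHS](reprK y) -Qp_piM.
rewrite -[in RHS](reprK x) -[in RHS](reprK y).
rewrite (padic_norm_pi_cst hN) (padic_norm_pi_cst hM) -rmorphM.
apply: (@padic_norm_pi_cst _ _ (maxn N M)) => n.
rewrite geq_max => /andP[Nn Mn].
by rewrite -(hN n) // -(hM n) // -padic_ratM.
Qed.

Lemma padic_normD (x y : Qp) : norm (x + y) <= Num.max (norm x) (norm y).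
Proof.
have [->|x0] := eqVneq x 0; first by rewrite add0r le_max lexx orbT.
have [->|y0] := eqVneq y 0; first by rewrite addr0 le_max lexx.
have [->|s0] := eqVneq (x + y) 0.
  by rewrite padic_norm0 le_max padic_norm_ge0.
have [N xN hN] := Qp_repr_nonnull x0; have [M yM hM] := Qp_repr_nonnull y0.
have s1 : ~ padic_null p (repr x + repr y : cauchy_seq).
  move=> h; move/eqP: s0; apply; rewrite -(reprK x) -(reprK y) -Qp_piD -Qp_pi0.
  by apply/Qp_pi_eq; rewrite subr0.
have [K sK hK] := padic_cauchy_nonnull p_pr (cauchy_seqP _) s1.
rewrite -(reprK x) -(reprK y) -Qp_piD.
rewrite (padic_norm_pi_cst hN) (padic_norm_pi_cst hM) (padic_norm_pi_cst hK).
pose L := maxn K (maxn N M).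
rewrite -(hN L) ?leq_max ?leqnn ?orbT // -(hM L) ?leq_max ?leqnn ?orbT //.
rewrite -(hK L) ?leq_max ?leqnn //.
by rewrite le_max !ler_rat -le_max; exact: padic_ratD.
Qed.

Lemma padic_norm_nat (n : nat) : norm n%:R = ratr (padic_rat p n%:R).
Proof.
have -> : (n%:R : Qp) = \pi_Qp n%:R.
  elim: n => [|n IH]; first by rewrite Qp_pi0.
  by rewrite -addn1 !natrD Qp_piD IH Qp_pi1.
apply: (@padic_norm_pi_cst _ _ 0%N) => m _; congr (padic_rat p _).
elim: n => [|n IH] //; rewrite -addn1 !natrD -IH.
by [].
Qed.

Lemma padic_norm_p : norm p%:R = p%:R^-1.
Proof.
rewrite padic_norm_nat.
have -> : (p%:R : rat) = (p%:Z)%:Q / (1 : int)%:Q by rewrite divr1.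
have p0 : p%:Z != 0 by rewrite -lt0n prime_gt0.
by rewrite padic_rat_fracE // absz_nat logn1 logn_prime // eqxx fmorphXz /= ratr_int.
Qed.

End Norm.

End PadicField.

Section Dynamics.
Variables (F : fieldType) (c : F).

Definition fwd (z : F * F) : F * F := (z.1 * z.2 + c, z.1).

Definition bwd (z : F * F) : option (F * F) :=
  if z.2 == 0 then None else Some (z.2, (z.1 - c) / z.2).

(* bwd is the partial inverse of fwd. *)
Lemma bwdP z w : bwd z = Some w <-> z.2 != 0 /\ fwd w = z.
Proof.
rewrite /bwd /fwd; case: z w => x y [u t] /=.
have [->|y0] := eqVneq y 0; split => //=; first by case.
  by case=> <- <-; split=> //; congr pair; field.
by case=> _ [<- uy]; move: y0; rewrite -uy => u0; congr (Some (_, _)); field.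
Qed.

(* None when the n-th backward iterate does not exist. *)
Definition bwdn (n : nat) (z : F * F) : option (F * F) :=
  iter n (obind bwd) (Some z).

Definition backward_defined : set (F * F) :=
  [set z | forall n, (0 < n)%N -> isSome (bwdn n z)].

End Dynamics.

Section JuliaSets.
Variables (R : realType) (p : nat) (p_pr : prime p) (c : Qp p_pr).

Definition padic_sup_norm (z : Qp p_pr * Qp p_pr) : R :=
  Num.max (padic_norm R z.1) (padic_norm R z.2).

Definition backward_julia : set (Qp p_pr * Qp p_pr) :=
  [set z | backward_defined c z /\
     exists M : R, forall n w, (0 < n)%N -> bwdn c n z = Some w ->
       padic_sup_norm w <= M].

Definition Zset : set (Qp p_pr * Qp p_pr) :=
  [set z | backward_defined c z /\
     padic_norm R z.1 = 1 /\ padic_norm R z.2 = 1].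

Definition Rset : set (Qp p_pr * Qp p_pr) :=
  [set z | backward_defined c z /\
     padic_norm R z.1 = padic_norm R c /\ padic_norm R z.2 = padic_norm R c].

End JuliaSets.

(* Main.v *)
(** Along a backward orbit the entries form one sequence [a] with
    [a n = a n.+1 * a n.+2 + c].  Nonzero p-adic norms are integer powers of
    [p], so no sequence of p-adic numbers has bounded, strictly increasing
    norms.  In a bounded orbit this first forces all the norms to be at most
    1.  If one of them equals 1, the recurrence makes all of them equal to 1.
    Otherwise a norm larger than [|c|] would be followed by a strictly larger
    one, and so on forever; so all norms are at most [|c|], and a norm smaller
    than [|c|] would give [|c| <= |c|^2]. *)
Require Import Defs.
From mathcomp Require Import all_boot all_order all_algebra.
From mathcomp Require Import all_classical all_reals all_analysis.
From mathcomp Require Import lra.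

Import Order.TTheory GRing.Theory Num.Theory.

Local Open Scope classical_set_scope.
Local Open Scope ring_scope.

(** The second coordinate of each iterate is the first coordinate of the next, so the first
    coordinates carry the whole orbit. *)
Lemma backward_orbit_seq (F : fieldType) (c : F) (z : F * F) :
  backward_defined c z ->
  exists a : nat -> F,
    (forall n, bwdn c n z = Some (a n, a n.+1)) /\
    (forall n, a n.+1 != 0 /\ a n = a n.+1 * a n.+2 + c).
Proof.
move=> zdef.
(* The default [z] is never reached, since every iterate exists. *)
pose w n := odflt z (bwdn c n z).
have wE n : bwdn c n z = Some (w n).
  by case: n => [//|n]; rewrite /w; case: bwdn (zdef n.+1 isT).
have wS n : (w n).2 != 0 /\ fwd c (w n.+1) = w n.
  by apply/bwdP; rewrite -wE /bwdn iterS -/(bwdn c n z) wE.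
have w2 n : (w n).2 = (w n.+1).1 by have [_ <-] := wS n.
exists (fun n => (w n).1); split=> n.
  by rewrite wE -w2 -surjective_pairing.
have [y0 e] := wS n; rewrite -!w2; split=> //.
by rewrite -{1}e /fwd /= -w2.
Qed.

(** * Isosceles rule and discreteness of the p-adic norm *)

Section PadicNorm.
Context {R : realType} {p : nat} {p_pr : prime p}.
Local Notation N := (@padic_norm p p_pr R).

Lemma padic_norm_gt0 (x : Qp p_pr) : (0 < N x) = (x != 0).
Proof. by rewrite lt_def padic_norm_eq0 padic_norm_ge0 andbT. Qed.

Lemma padic_normN (x : Qp p_pr) : N (- x) = N x.
Proof.
apply/eqP; rewrite -(@eqrXn2 _ 2) ?padic_norm_ge0 //.
by rewrite !expr2 -!padic_normM mulrNN.
Qed.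

Lemma padic_normV (x : Qp p_pr) : N (x^-1) = (N x)^-1.
Proof.
have [->|x0] := eqVneq x 0; first by rewrite invr0 padic_norm0 invr0.
have Nx0 : N x != 0 by rewrite padic_norm_eq0.
apply: (mulfI Nx0); rewrite -padic_normM !divff //.
by apply: (mulfI Nx0); rewrite -padic_normM !mulr1.
Qed.

(** If [N (x - y)] were smaller, both terms of [x = (x - y) + y] would have norm below [N x]. *)
Lemma padic_norm_subl (x y : Qp p_pr) : N y < N x -> N (x - y) = N x.
Proof.
move=> yx; apply/eqP; rewrite eq_le; apply/andP; split.
  apply: le_trans (padic_normD _ _ _) _.
  by rewrite padic_normN ge_max lexx ltW.
have := padic_normD R (x - y) y.
by rewrite subrK le_max => /orP[//|]; rewrite leNgt yx.
Qed.

(** Distinct integer powers of [p] differ by a factor of at least [p]. *)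
Lemma padic_norm_lt_mulp (x y : Qp p_pr) : N x < N y -> p%:R * N x <= N y.
Proof.
move=> xy; have [x0|x0] := eqVneq x 0.
  by rewrite x0 padic_norm0 mulr0 padic_norm_ge0.
have y0 : y != 0 by rewrite -padic_norm_gt0 (le_lt_trans (padic_norm_ge0 R x)).
have p1 : 1 < p%:R :> R by rewrite ltr1n prime_gt1.
have [k xk] := padic_norm_expz R x0; have [l yl] := padic_norm_expz R y0.
move: xy; rewrite xk yl ltr_eXz2l // => kl.
by rewrite -{1}[p%:R]expr1z -expfzDr ?gt_eqF ?(lt_trans ltr01) // ler_eXz2l ?lez1D.
Qed.

Lemma padic_norm_incr_unbounded (b : nat -> Qp p_pr) (M : R) :
  (forall n, N (b n) < N (b n.+1)) -> ~ (forall n, N (b n) <= M).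
Proof.
move=> incr bnd.
have b1 : 0 < N (b 1%N) := le_lt_trans (padic_norm_ge0 R _) (incr 0%N).
(* Linear growth suffices: each step at least doubles the norm, so it adds at least [N (b 1%N)]. The
   start is [b 1%N] because [b 0%N] may be zero. *)
have growth n : n%:R * N (b 1%N) <= N (b n.+1).
  elim: n => [|n IH]; first by rewrite mul0r padic_norm_ge0.
  have p2 : 2 <= p%:R :> R by rewrite ler_nat prime_gt1.
  have := padic_norm_lt_mulp _ _ (incr n.+1).
  have : N (b 1%N) <= N (b n.+1).
    elim: n {IH} => // n IH; exact: le_trans IH (ltW (incr _)).
  by rewrite -natr1 mulrDl; nra.
have := truncnS_gt (M / N (b 1%N)); rewrite ltr_pdivrMr // ltNge => /negP; apply.
exact: le_trans (growth _) (bnd _).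
Qed.

End PadicNorm.

(** * Norms along the recurrence *)

Section Recurrence.
Context {R : realType} {p : nat} {p_pr : prime p}.
Local Notation N := (@padic_norm p p_pr R).
Variables (c : Qp p_pr) (a : nat -> Qp p_pr).
Hypothesis c_lt1 : N c < 1.
Hypothesis a_neq0 : forall n, a n.+1 != 0.
Hypothesis aE : forall n, a n = a n.+1 * a n.+2 + c.

Lemma orbit_mulE n : N (a n.+1) * N (a n.+2) = N (a n - c).
Proof. by rewrite -padic_normM (aE n) addrK. Qed.

Lemma orbit_mul_gt n : N c < N (a n) -> N (a n.+1) * N (a n.+2) = N (a n).
Proof. by move=> cn; rewrite orbit_mulE padic_norm_subl. Qed.

Lemma orbit_mul_lt n : N (a n) < N c -> N (a n.+1) * N (a n.+2) = N c.
Proof. by move=> cn; rewrite orbit_mulE -opprB padic_normN padic_norm_subl. Qed.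

Lemma orbit_mul_le n : N (a n.+1) * N (a n.+2) <= Num.max (N (a n)) (N c).
Proof. by rewrite orbit_mulE -(padic_normN c) padic_normD. Qed.

Lemma orbit_gt0 n : 0 < N (a n.+1).
Proof. by rewrite padic_norm_gt0. Qed.

Lemma orbit_norm1_succ n : N (a n) = 1 -> N (a n.+1) = 1 -> N (a n.+2) = 1.
Proof.
by move=> n0 n1; have := orbit_mul_gt n; rewrite n0 n1 mul1r; apply.
Qed.

Lemma orbit_norm1 n : N (a 0%N) = 1 -> N (a 1%N) = 1 -> N (a n) = 1.
Proof.
move=> a0 a1; suff: N (a n) = 1 /\ N (a n.+1) = 1 by case.
by elim: n => [//|n [n0 n1]]; split=> //; exact: orbit_norm1_succ.
Qed.

(** * Bounded orbits *)

Section Bounded.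
Variable M : R.
Hypothesis a_le : forall n, N (a n) <= M.

(* Every second norm then increases strictly. *)
Lemma orbit_gt1_lt1_false n : 1 < N (a n) -> N (a n.+1) < 1 -> False.
Proof.
move=> an an1.
have step m : 1 < N (a m) -> N (a m.+1) < 1 ->
    N (a m) < N (a m.+2) /\ N (a m.+3) < 1.
  move=> am am1.
  have E := orbit_mul_gt m (lt_trans c_lt1 am).
  have m2 : N (a m) < N (a m.+2) by have := orbit_gt0 m.+1; nra.
  (* This product is below 1 and its first factor exceeds 1, so the pair at [m.+2] again lies on
     both sides of 1. *)
  split=> //; have : N (a m.+2) * N (a m.+3) < 1.
    by apply: le_lt_trans (orbit_mul_le _) _; rewrite gt_max am1.
  by have := orbit_gt0 m.+2; nra.
have inv k : 1 < N (a (n + k.*2)%N) /\ N (a (n + k.*2).+1%N) < 1.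
  elim: k => [|k [k0 k1]]; first by rewrite addn0.
  have [k2 k3] := step _ k0 k1.
  by rewrite doubleS !addnS; split=> //; exact: lt_trans k2.
apply: (@padic_norm_incr_unbounded R p p_pr (fun k => a (n + k.*2)%N) M) => k //.
by have [k0 k1] := inv k; rewrite doubleS !addnS; have [] := step _ k0 k1.
Qed.

(** A norm above 1 would keep all later norms above 1; then [N (a k)] is the product of the next two
    norms and exceeds each of them, so the norms decrease strictly. *)
Lemma orbit_le1 n : N (a n) <= 1.
Proof.
rewrite leNgt; apply/negP => an.
have succ m : 1 < N (a m) -> 1 < N (a m.+1).
  move=> am; case: (ltgtP (N (a m.+1)) 1) => // am1.
    by case: (orbit_gt1_lt1_false m am am1).
  (* If [N (a m.+1) = 1], then [N (a m.+2) = N (a m) > 1] and [N (a m.+2) * N (a m.+3) = 1], which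
     gives the excluded pair at [m.+2]. *)
  have E := orbit_mul_gt m (lt_trans c_lt1 am).
  rewrite am1 mul1r in E.
  have c1 : N c < N (a m.+1) by rewrite am1.
  have E' := orbit_mul_gt _ c1; rewrite am1 in E'.
  exfalso; apply: (orbit_gt1_lt1_false m.+2); first by rewrite E.
  by rewrite E in E'; have := orbit_gt0 m.+2; nra.
have all k : 1 < N (a (n + k)%N).
  by elim: k => [|k IH]; rewrite ?addn0 // addnS succ.
(* Inverting turns the strict decrease above 1 into a strict increase below 1. *)
apply: (@padic_norm_incr_unbounded R p p_pr (fun k => (a (n + k)%N)^-1) 1) => k.
  rewrite !padic_normV ltf_pV2 ?posrE ?(lt_trans ltr01) //.
  have := orbit_mul_gt _ (lt_trans c_lt1 (all k)).
  by have := all k.+1; have := all k.+2; rewrite !addnS; nra.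
by rewrite padic_normV invf_le1 ?ltW // (lt_trans ltr01).
Qed.

(** Forward, two norms at most 1 with product 1 both equal 1. Backward, a product equal to 1 is at
    most the maximum of [N (a m)] and [N c < 1], so [N (a m)] reaches 1. *)
Lemma orbit_norm1_back n : N (a n) = 1 -> N (a 0%N) = 1 /\ N (a 1%N) = 1.
Proof.
have next m : N (a m) = 1 -> N (a m.+1) = 1.
  move=> am; have := orbit_mul_gt m; rewrite am => /(_ c_lt1) E.
  have := orbit_le1 m.+1; have := orbit_le1 m.+2.
  by have := orbit_gt0 m; have := orbit_gt0 m.+1; nra.
suff back : N (a n) = 1 -> N (a 0%N) = 1 by move=> /back a0; split=> //; exact: next.
elim: n => [//|m IH am]; apply: IH.
have := orbit_mul_le m; rewrite am (next _ am) mulr1 le_max [_ <= N c]leNgt c_lt1 orbF.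
by move=> ?; apply/eqP; rewrite eq_le orbit_le1.
Qed.

Lemma orbit_lt1_normc n : (forall m, N (a m) < 1) -> N (a n) = N c.
Proof.
move=> lt1.
have le_c m : N (a m) <= N c.
  rewrite leNgt; apply/negP => cm.
  have incr k : N c < N (a k) -> N (a k) < N (a k.+1).
    move=> ck; have := orbit_mul_gt k ck; have := lt1 k.+2.
    by have := orbit_gt0 k; nra.
  have gt_c k : N c < N (a (m + k)%N).
    elim: k => [|k IH]; rewrite ?addn0 // addnS.
    exact: lt_trans IH (incr _ IH).
  apply: (@padic_norm_incr_unbounded R p p_pr (fun k => a (m + k)%N) M) => k //.
  by rewrite addnS incr.
apply/eqP; rewrite eq_le le_c leNgt; apply/negP => /orbit_mul_lt.
(* Otherwise [N c] would be a product of a positive norm at most [N c] and a norm below 1. *)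
have := le_c n.+1; have := lt1 n.+2.
by have := orbit_gt0 n; have := orbit_gt0 n.+1; nra.
Qed.

End Bounded.
End Recurrence.

Theorem theorem3p1 (R : realType) (p : nat) (p_pr : prime p) (p_odd : odd p)
    (c : Qp p_pr) (hc : padic_norm R c < 1) :
  Zset R c `<=` backward_julia R c /\
  backward_julia R c `<=` Rset R c `|` Zset R c.
Proof.
split=> z [zdef].
  have [a [wE rec]] := backward_orbit_seq _ _ _ zdef.
  have [a0 aE] : (forall n, a n.+1 != 0) /\ (forall n, a n = a n.+1 * a n.+2 + c).
    by split=> n; have [] := rec n.
  have zE : z = (a 0%N, a 1%N) by have := wE 0%N => -[].
  rewrite {1 2}zE => -[x1 y1]; split=> //.
  exists 1 => n w _; rewrite wE => -[<-]; rewrite /padic_sup_norm /=.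
  have norm1 m := orbit_norm1 c a hc aE m x1 y1.
  by rewrite !norm1 maxxx.
move=> [M bnd].
have [a [wE rec]] := backward_orbit_seq _ _ _ zdef.
have [a0 aE] : (forall n, a n.+1 != 0) /\ (forall n, a n = a n.+1 * a n.+2 + c).
  by split=> n; have [] := rec n.
(* [M] bounds only the iterates of positive index, so [a 0%N] is added by hand. *)
have a_le n : padic_norm R (a n) <= Num.max M (padic_norm R (a 0%N)).
  case: n => [|n]; rewrite le_max ?lexx ?orbT //.
  have := bnd n.+1 _ isT (wE n.+1); rewrite /padic_sup_norm ge_max /=.
  by case/andP => ->.
have zE : z = (a 0%N, a 1%N) by have := wE 0%N => -[].
(* A norm equal to 1 puts [z] in [Zset]; otherwise all norms are below 1 and [z] lies in [Rset]. *)
have [[n an]|no1] := pselect (exists n, padic_norm R (a n) = 1).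
  right; split=> //; rewrite zE /=.
  exact: (orbit_norm1_back c a hc a0 aE _ a_le n).
left; split=> //; rewrite zE /=.
have lt1 m : padic_norm R (a m) < 1.
  rewrite lt_neqAle (orbit_le1 c a hc a0 aE _ a_le) andbT.
  by apply: contra_notN no1 => /eqP am; exists m.
have normc n := orbit_lt1_normc c a a0 aE _ a_le n lt1.
by rewrite !normc.
Qed.
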